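(* Let $\mathcal{A}$ be an alphabet and let $x \in \mathcal{A}^{\mathbb{Z}}$ be a bi-infinite word. The following are equivalent: (1) $x$ is eventually dendric, with threshold $N$; (2) $x$ is eventually acyclic, with threshold $M$; (2') $x$ is eventually neutral, with threshold $M'$; (3) $x$ is eventually weak or neutral, with threshold $K$. Moreover (when these equivalent properties hold, and denoting by $N, M, M', K$ the respective thresholds), $K \leq M \leq N$ and $K \leq M' \leq N$.
   Context: An alphabet is a finite set of letters (of size at least 2). For $x \in \mathcal{A}^{\mathbb{Z}}$, $\mathcal{L}(x)$ is the set of finite factors of $x$ (including the empty word), and $\mathcal{L}_{\geq n}(x)$ is the set of factors of length at least $n$. For $w \in \mathcal{L}(x)$ define $E^-_x(w) = \{a \in \mathcal{A} \mid aw \in \mathcal{L}(x)\}$, $E^+_x(w) = \{b \in \mathcal{A} \mid wb \in \mathcal{L}(x)\}$, $E_x(w) = \{(a,b) \in \mathcal{A}\times\mathcal{A} \mid awb \in \mathcal{L}(x)\}$, and the multiplicity $m_x(w) = \# E_x(w) - \# E^-_x(w) - \# E^+_x(w) + 1$. The word $w$ is neutral if $m_x(w) = 0$, and weak if $m_x(w) < 0$. The extension graph of $w$ in $x$ is the undirected bipartite graph whose vertex set is the disjoint union of $E^-_x(w)$ and $E^+_x(w)$, with an edge between $a \in E^-_x(w)$ and $b \in E^+_x(w)$ iff $(a,b) \in E_x(w)$. The word $w$ is dendric (resp., acyclic) if its extension graph is a tree (resp., has no cycle). For a property $P$ among ''neutral'', ''weak or neutral'', ''dendric'', ''acyclic'',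 the bi-infinite word $x$ is eventually $P$ if there exists $n \geq 0$ such that all words of $\mathcal{L}_{\geq n}(x)$ satisfy $P$; the smallest such $n$ is called the threshold. *)

(* Defs.v *)
(* MathComp, with the classical sets of mathcomp-classical. *)
From HB Require Import structures.
From mathcomp Require Import all_boot all_order all_algebra.
From mathcomp Require Import boolp classical_sets.

Set Implicit Arguments.
Unset Strict Implicit.
Unset Printing Implicit Defensive.

Import Order.TTheory GRing.Theory Num.Theory.

Local Open Scope ring_scope.

(* A simple graph on a finite vertex type V is given by its adjacency relation,
   which is expected to be symmetric and irreflexive. *)
Section Graphs.
Variables (V : finType) (e : rel V).

(* [ucycle e c]: the vertices of c are pairwise distinct, and cyclically
   consecutive ones are adjacent. An edge u - v gives the closed walk [:: u; v],
   which is not a cycle, hence the bound on the size. *)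
Definition graph_acyclic : Prop :=
  forall c : seq V, (2 < size c)%N -> ~ ucycle e c.

Definition graph_connected : Prop :=
  (0 < #|V|)%N /\ forall u v : V, connect e u v.

Definition graph_tree : Prop := graph_connected /\ graph_acyclic.

End Graphs.

Section BiinfiniteWords.
Variables (A : finType) (x : int -> A).

Definition language : set (seq A) :=
  [set w | exists (i : int) (n : nat), w = mkseq (fun k => x (i + k%:Z)) n].

Definition language_ge (n : nat) : set (seq A) :=
  [set w | language w /\ (n <= size w)%N].

(* [`[< P >]] is the boolean reflecting the (undecidable) proposition P. *)
Definition left_ext (w : seq A) : {set A} :=
  [set a | `[< language (a :: w) >]]%SET.

Definition right_ext (w : seq A) : {set A} :=
  [set b | `[< language (rcons w b) >]]%SET.

Definition bi_ext (w : seq A) : {set A * A} :=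
  [set ab | `[< language (ab.1 :: rcons w ab.2) >]]%SET.

Definition multiplicity (w : seq A) : int :=
  #|bi_ext w|%:Z - #|left_ext w|%:Z - #|right_ext w|%:Z + 1.

Definition neutral (w : seq A) : Prop := multiplicity w = 0.

Definition weak (w : seq A) : Prop := multiplicity w < 0.

Definition weak_or_neutral (w : seq A) : Prop := weak w \/ neutral w.

Definition ext_vertex (w : seq A) : finType :=
  ({a : A | a \in left_ext w} + {b : A | b \in right_ext w})%type.

Definition ext_edge (w : seq A) : rel (ext_vertex w) :=
  fun u v =>
    match u, v with
    | inl a, inr b | inr b, inl a => (val a, val b) \in bi_ext w
    | _, _ => false
    end.

Definition dendric (w : seq A) : Prop := graph_tree (@ext_edge w).

Definition acyclic (w : seq A) : Prop := graph_acyclic (@ext_edge w).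

Definition holds_from (P : seq A -> Prop) (n : nat) : Prop :=
  forall w : seq A, language_ge n w -> P w.

Definition eventually (P : seq A -> Prop) : Prop :=
  exists n : nat, holds_from P n.

Definition is_threshold (P : seq A -> Prop) (n : nat) : Prop :=
  holds_from P n /\ forall m : nat, holds_from P m -> (n <= m)%N.

End BiinfiniteWords.

(* Main.v *)
(* Write t(w) = #E^-(w) - 1. Counting E(w) by its second component gives
   sum_b t(wb) = m(w) + t(w) over b in E^+(w), and t(wb) <= t(w). So if w is
   weak or neutral then sum_b t(wb)^2 <= t(w)^2, and equality forces some b0
   with t(w b0) = t(w) and t(wb) = 0 for b <> b0: the extension graph of w is
   then a tree, since every left vertex is adjacent to b0 and every other right
   vertex is a leaf. When all long words are weak or neutral, the sum of t(w)^2
   over the words w of length n is thus eventually nonincreasing in n, hence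
   eventually constant, and equality holds at every long enough w.
   The comparison of thresholds only uses that a forest on v > 0 vertices has at
   most v - 1 edges, and a tree exactly v - 1. *)
Require Import Defs.
From mathcomp Require Import all_boot all_order all_algebra.
From mathcomp Require Import boolp zify.

Set Implicit Arguments.
Unset Strict Implicit.
Unset Printing Implicit Defensive.

(** * Edge counts of forests and of connected graphs *)

Section EdgeCounts.
Variables (V : finType) (e : rel V).
Hypotheses (e_sym : symmetric e) (e_irr : irreflexive e).

(* Each undirected edge inside S is counted twice. *)
Definition arcs_in (S : {set V}) : nat := \sum_(u in S) \sum_(v in S) e u v.

Lemma arcs_in_setD1 (S : {set V}) (v : V) : v \in S ->
  arcs_in S = (arcs_in (S :\ v) + (\sum_(u in S :\ v) e v u).*2)%N.
Proof.
move=> vS; rewrite /arcs_in (big_setD1 v vS) /= (big_setD1 v vS) /= e_irr add0n.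
under [X in (_ + X)%N]eq_bigr => u _ do rewrite (big_setD1 v vS) /= e_sym.
by rewrite big_split /= addnA addnn addnC.
Qed.

(** Otherwise every vertex of [S] has a neighbour in [S] other than any prescribed vertex, so a
    simple path in [S] can be prolonged at its head without ever turning back, beyond [#|V|]
    vertices. *)
Lemma acyclic_low_degree (S : {set V}) : graph_acyclic e -> S != set0 ->
  exists2 v, v \in S & (\sum_(u in S :\ v) e v u <= 1)%N.
Proof.
move=> acy /set0Pn[x0 x0S]; apply: contrapT => no_leaf.
have other_nbr v z : v \in S -> exists y, [/\ y \in S, e v y & y != z].
  move=> vS; apply: contrapT => noy; apply: no_leaf; exists v => //.
  have nbr_z u : u \in S :\ v -> u != z -> (e v u : nat) = 0.
    rewrite inE => /andP[_ uS] uz; case evu: (e v u) => //.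
    by case: noy; exists u.
  have [zS|zS] := boolP (z \in S :\ v).
    rewrite (big_setD1 z zS) /= big1 ?addn0 ?leq_b1 // => u.
    by rewrite inE => /andP[]; rewrite inE => uz uS; apply: nbr_z.
  rewrite big1 // => u uS; apply: nbr_z => //.
  by apply: contraNneq zS => <-.
have long n : exists x z p, [/\ size p = n, path e x (z :: p),
    uniq (x :: z :: p) & all (mem S) (x :: z :: p)].
  elim: n => [|n [x [z [p [szp pxp uxp Sxp]]]]].
    have [y [yS exy yx]] := other_nbr x0 x0 x0S.
    exists x0, y, [::]; split=> //=; rewrite ?exy ?inE ?x0S ?yS //.
    by rewrite eq_sym yx.
  have xS : x \in S by move/andP: Sxp => [].
  have [y [yS exy yz]] := other_nbr x z xS.
  have yx : y != x by apply: contraTneq exy => ->; rewrite e_irr.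
  (* If [y] is already on the path, it lies beyond [z], so the stretch from [x] to [y] has at least
     three vertices and the edge from [y] to [x] closes it into a cycle. *)
  have [yp|yp] := boolP (y \in p).
    case/splitPr: yp szp pxp uxp Sxp => p1 p2 _ pxp uxp _.
    case: (acy (x :: z :: rcons p1 y)); first by rewrite /= size_rcons.
    rewrite /ucycle; apply/andP; split.
      move: pxp; rewrite -cat_rcons -cat_cons cat_path => /andP[pxp _].
      by rewrite /cycle rcons_path pxp /= last_rcons e_sym.
    by move: uxp; rewrite -cat_rcons -!cat_cons cat_uniq => /andP[].
  exists y, x, (z :: p); split => //=; first by rewrite szp.
  - by rewrite e_sym exy.
  - by rewrite !inE (negPf yx) (negPf yz) (negPf yp).
  - by rewrite yS.
have [x [z [p [szp _ uxp _]]]] := long #|V|.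
have := max_card (mem (x :: z :: p)).
by rewrite (card_uniqP uxp) /= szp ltnNge leqnSn.
Qed.

(** Vertices of degree at most 1 are removed one by one; each removal costs at most two arcs, and
    the last vertex costs none. *)
Lemma acyclic_arcs (S : {set V}) : graph_acyclic e -> S != set0 ->
  (arcs_in S <= (#|S|.-1).*2)%N.
Proof.
move=> acy; have [n] := ubnP #|S|; elim: n S => // n IHn S ltSn S0.
have [v vS dv] := acyclic_low_degree acy S0.
rewrite (arcs_in_setD1 vS); move: ltSn; rewrite (cardsD1 v) vS => ltSn.
have [Sv0|Sv0] := eqVneq (S :\ v) set0.
  by rewrite Sv0 /arcs_in !big_set0.
have := IHn _ ltSn Sv0; have : (0 < #|S :\ v|)%N by rewrite card_gt0.
lia.
Qed.

(** A set is grown from a root [r], each time along an edge leaving it, which adds one vertex and at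
    least two arcs. *)
Lemma connected_arcs : graph_connected e ->
  ((#|V|.-1).*2 <= arcs_in [set: V])%N.
Proof.
case=> V0 conn; have /card_gt0P[r _] := V0.
have grow n : (n < #|V|)%N -> exists S : {set V},
    [/\ r \in S, #|S| = n.+1 & (n.*2 <= arcs_in S)%N].
  elim: n => [|n IHn] ltn; first by exists [set r]; rewrite set11 cards1.
  have [S [rS cS aS]] := IHn (ltnW ltn).
  (* If no edge left [S], every walk from [r] would stay in [S], and [S] would contain all
     vertices. *)
  have [u [v [uS vS euv]]] : exists u v, [/\ u \in S, v \notin S & e u v].
    apply: contrapT => closedS; move: ltn; rewrite -cS ltnNge => /negP; apply.
    apply/subset_leq_card/subsetP => v _.
    have walk z p : path e z p -> z \in S -> last z p \in S.
      elim: p z => //= y p IHp z /andP[ezy pth] zS; apply: IHp pth _.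
      by apply: contrapT => /negP yS; apply: closedS; exists z, y.
    by have /connectP[p pth ->] := conn r v; apply: walk pth rS.
  exists (v |: S); split; first by rewrite inE rS orbT.
    by rewrite cardsU1 vS cS.
  rewrite (@arcs_in_setD1 _ v) ?setU11 // setU1K // (big_setD1 u uS) /=.
  rewrite e_sym euv; lia.
have [|S [_ cS aS]] := grow #|V|.-1; first by rewrite prednK.
have -> // : [set: V] = S.
by apply/eqP; rewrite eq_sym eqEcard subsetT cS prednK // cardsT leqnn.
Qed.

End EdgeCounts.

(** Induction on a bound for [u K]: after any strict drop the argument restarts from a smaller
    value. *)
Lemma eventually_constant (u : nat -> nat) (K : nat) :
  (forall n, (K <= n)%N -> (u n.+1 <= u n)%N) ->
  exists N, forall n, (N <= n)%N -> u n.+1 = u n.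
Proof.
have [m] := ubnP (u K); elim: m K => // m IHm K ltKm u_dec.
have [[n [leKn neq]]|cst] := pselect (exists n, (K <= n)%N /\ u n.+1 <> u n).
  have leuK : (u n <= u K)%N.
    elim: n leKn {neq} => [|n IHn]; first by rewrite leqn0 => /eqP->.
    rewrite leq_eqVlt => /predU1P[<- //|leKn].
    exact: leq_trans (u_dec _ leKn) (IHn leKn).
  apply: (IHm n.+1); first by have := u_dec _ leKn; lia.
  by move=> k ltnk; apply: u_dec; lia.
by exists K => n leKn; apply: contrapT => neq; apply: cst; exists n.
Qed.

(** * Extensions of words and their extension graphs *)

Section Extensions.
Variables (A : finType) (x : int -> A).
Implicit Types (w : seq A) (a b : A).

Lemma language_cons a w : language x (a :: w) -> language x w.
Proof.
case=> i [[//|n]] [_ ->]; exists (i + 1)%R, n.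
rewrite /mkseq -[1%N]/(1 + 0)%N iotaDl -map_comp; apply: eq_map => k /=.
by congr x; lia.
Qed.

Lemma language_rcons w b : language x (rcons w b) -> language x w.
Proof.
case=> i [[|n]]; first by case: w.
by rewrite mkseqS => /rcons_inj[-> _]; exists i, n.
Qed.

Lemma language_catl v w : language x (v ++ w) -> language x v.
Proof.
elim/last_ind: w => [|w b IHw]; first by rewrite cats0.
by rewrite -rcons_cat => /language_rcons.
Qed.

Lemma left_ext_neq0 w : language x w -> (0 < #|left_ext x w|)%N.
Proof.
case=> i [n ->]; apply/card_gt0P; exists (x (i - 1)).
rewrite inE; apply/asboolP.
exists (i - 1)%R, n.+1; rewrite /mkseq /= -[1%N]/(1 + 0)%N iotaDl -map_comp.
congr (x _ :: _); first lia.
by apply: eq_map => k /=; congr x; lia.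
Qed.

Lemma right_ext_neq0 w : language x w -> (0 < #|right_ext x w|)%N.
Proof.
case=> i [n ->]; apply/card_gt0P; exists (x (i + n%:Z)).
by rewrite inE; apply/asboolP; exists i, n.+1; rewrite mkseqS.
Qed.

(** The link between consecutive lengths: the left extensions of [rcons w b] are the neighbours of
    [b] in the extension graph of [w]. *)
Lemma mem_left_ext_rcons w a b :
  (a \in left_ext x (rcons w b)) = ((a, b) \in bi_ext x w).
Proof. by rewrite !inE. Qed.

Lemma bi_ext_left w a b : (a, b) \in bi_ext x w -> a \in left_ext x w.
Proof.
rewrite !inE => /asboolP; rewrite -rcons_cons => /language_rcons.
by move/asboolP.
Qed.

Lemma bi_ext_right w a b : (a, b) \in bi_ext x w -> b \in right_ext x w.
Proof. by rewrite !inE => /asboolP/language_cons/asboolP. Qed.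

Lemma mem_right_ext w b : (b \in right_ext x w) = `[< language x (rcons w b) >].
Proof. by rewrite inE. Qed.

Lemma card_bi_ext w :
  #|bi_ext x w| = (\sum_(b in right_ext x w) #|left_ext x (rcons w b)|)%N.
Proof.
under eq_bigr => b _ do rewrite -sum1_card.
rewrite -sum1_card (exchange_big_dep xpredT) //= pair_big_dep /=.
apply: eq_bigl => -[a b] /=; rewrite mem_left_ext_rcons.
by case: (boolP (_ \in bi_ext x w)) => [/bi_ext_right->|]; rewrite ?andbF.
Qed.

Lemma ext_edge_sym w : symmetric (@ext_edge A x w).
Proof. by move=> [a|b] [a'|b']. Qed.

Lemma ext_edge_irr w : irreflexive (@ext_edge A x w).
Proof. by case. Qed.

Lemma card_ext_vertex w :
  #|ext_vertex x w| = (#|left_ext x w| + #|right_ext x w|)%N.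
Proof. by rewrite card_sum !card_sig. Qed.

(** Split by sides, the arcs form four blocks: left-left and right-right are empty, and each of the
    other two counts [bi_ext x w]. *)
Lemma arcs_ext_edge w :
  arcs_in (@ext_edge A x w) [set: _] = (#|bi_ext x w|).*2.
Proof.
have card_bi : (\sum_(a : {a | a \in left_ext x w})
    \sum_(b : {b | b \in right_ext x w})
      ((val a, val b) \in bi_ext x w) = #|bi_ext x w|)%N.
  rewrite exchange_big card_bi_ext [RHS]big_sub /=. apply: eq_bigr => b _.
  rewrite -(big_sub (left_ext x w) (fun a => (a, val b) \in bi_ext x w : nat)).
  rewrite -sum1_card big_mkcond [RHS]big_mkcond; apply: eq_bigr => a _.
  rewrite mem_left_ext_rcons.
  by case: (boolP (_ \in bi_ext x w)) => [/bi_ext_left->|]; rewrite ?if_same.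
rewrite /arcs_in; under eq_bigl => u do rewrite inE.
under eq_bigr => u _ do under eq_bigl => v do rewrite inE.
rewrite big_sumType /=.
under eq_bigr => a _ do rewrite big_sumType /= big1 ?add0n //.
under [X in (_ + X)%N]eq_bigr => b _ do
  rewrite big_sumType /= [X in (_ + X)%N]big1 ?addn0 //.
by rewrite [X in (_ + X)%N]exchange_big /= card_bi addnn.
Qed.

Lemma acyclic_weak_or_neutral w :
  language x w -> acyclic x w -> weak_or_neutral x w.
Proof.
move=> Lw acy; have l0 := left_ext_neq0 Lw; have r0 := right_ext_neq0 Lw.
have : [set: ext_vertex x w] != set0.
  by rewrite -card_gt0 cardsT card_ext_vertex; lia.
move/(acyclic_arcs (@ext_edge_sym w) (@ext_edge_irr w) acy).
rewrite arcs_ext_edge cardsT card_ext_vertex.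
rewrite /weak_or_neutral /weak /neutral /multiplicity; lia.
Qed.

Lemma dendric_neutral w : language x w -> dendric x w -> neutral x w.
Proof.
move=> Lw [conn acy]; have l0 := left_ext_neq0 Lw; have r0 := right_ext_neq0 Lw.
have := connected_arcs (@ext_edge_sym w) (@ext_edge_irr w) conn.
rewrite arcs_ext_edge card_ext_vertex.
(* The lower bound on edges given by connectedness excludes the weak case. *)
have [|] := acyclic_weak_or_neutral Lw acy => //.
rewrite /weak /neutral /multiplicity; lia.
Qed.

Lemma dendric_of_dominating_ext w b0 : language x w ->
  b0 \in right_ext x w -> left_ext x (rcons w b0) = left_ext x w ->
  (forall b, b \in right_ext x w -> b != b0 ->
     (#|left_ext x (rcons w b)| <= 1)%N) ->
  dendric x w.
Proof.
move=> Lw b0R domb0 lone.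
have b0_edge (a : {a | a \in left_ext x w})
    (b0' : {b | b \in right_ext x w}) :
    val b0' = b0 -> @ext_edge A x w (inl a) (inr b0').
  by rewrite /= -mem_left_ext_rcons => ->; rewrite domb0 (valP a).
split; [split|].
- by rewrite card_ext_vertex addn_gt0 left_ext_neq0.
- pose r : ext_vertex x w := inr (Sub b0 b0R).
  have conn_inl (a : {a | a \in left_ext x w}) :
      connect (@ext_edge A x w) r (inl a).
    by apply/connect1; rewrite ext_edge_sym; apply: b0_edge.
  have conn_r u : connect (@ext_edge A x w) r u.
    case: u => [//|b].
    have : language x (rcons w (val b)).
      by have := valP b; rewrite mem_right_ext => /asboolP.
    move/left_ext_neq0/card_gt0P=> [a]; rewrite mem_left_ext_rcons => ab.
    pose a' : {a | a \in left_ext x w} := Sub a (bi_ext_left ab).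
    by apply: connect_trans (conn_inl a') _; apply: connect1.
  move=> u v; apply: connect_trans (conn_r v).
  by rewrite (sym_connect_sym (@ext_edge_sym w)).
have deg2 (b : {b | b \in right_ext x w})
    (a a' : {a | a \in left_ext x w}) : @ext_edge A x w (inl a) (inr b) ->
    @ext_edge A x w (inl a') (inr b) -> a != a' -> val b = b0.
  rewrite /= -!mem_left_ext_rcons => ab a'b ne; apply/eqP/negPn/negP => bb0.
  have := lone _ (valP b) bb0; rewrite leqNgt => /negP; apply.
  by apply/card_gt1P; exists (val a), (val a').
(* A cycle alternates sides, so it meets two distinct right vertices [b] and [b'], each with two
   distinct left neighbours; by [deg2] both equal [b0]. *)
have acy (b : {b | b \in right_ext x w}) c : (1 < size c)%N ->
    ~ ucycle (@ext_edge A x w) (inr b :: c).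
  case: c => [//|u [//|v s]] _ /andP[] /=.
  case: u => [a|//]; case: v => [a'|b']; first by rewrite andbF.
  rewrite rcons_path => /and3P[eba eab' /andP[pth last_b]] unq.
  have ba : @ext_edge A x w (inl a) (inr b) by rewrite ext_edge_sym.
  case: s pth last_b unq => [//|[a2|//] s] /= /andP[b'a2 _] last_b.
  case: (last _ _) (mem_last (inl a2) s) last_b => [a1|//] a1s a1b.
  rewrite !inE !negb_or => /and3P[/and3P[_ bb' _] /andP[_ /andP[ne_a2 as_]] _].
  have aa2 : a != a2 by apply: contraNneq ne_a2 => ->.
  have aa1 : a != a1.
    by move: a1s; apply: contraTneq => <-; rewrite inE negb_or ne_a2.
  case/eqP: bb'; congr inr; apply: val_inj.
  by rewrite (deg2 b a a1) // (deg2 b' a a2).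
(* A cycle starting on the left is rotated by one step to start on the right. *)
move=> [//|[a|b] c] sc uc; last exact: acy sc uc.
case: c sc uc => [//|[a'|b] c] sc /andP[cyc unq]; first by case/andP: cyc.
apply: (acy b (rcons c (inl a))); first by rewrite size_rcons.
have -> : inr b :: rcons c (inl a) = rot 1 [:: inl a, inr b & c]
    :> seq (ext_vertex x w).
  by rewrite rot1_cons.
by rewrite /ucycle rot_cycle rot_uniq cyc.
Qed.

(** * Squares of left excesses, summed over right extensions *)

Definition lexcess w : nat := #|left_ext x w|.-1.

Lemma sum_lexcess w : language x w -> weak_or_neutral x w ->
  (\sum_(b in right_ext x w) lexcess (rcons w b) <= lexcess w)%N.
Proof.
move=> Lw wn; have l0 := left_ext_neq0 Lw; have r0 := right_ext_neq0 Lw.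
have : #|bi_ext x w| =
    (\sum_(b in right_ext x w) lexcess (rcons w b) + #|right_ext x w|)%N.
  rewrite card_bi_ext -sum1_card -big_split /=; apply: eq_bigr => b.
  by rewrite mem_right_ext => /asboolP/left_ext_neq0; rewrite /lexcess; lia.
move: wn; rewrite /weak_or_neutral /weak /neutral /multiplicity /lexcess.
lia.
Qed.

Lemma lexcess_rcons w b : (lexcess (rcons w b) <= lexcess w)%N.
Proof.
suff : (#|left_ext x (rcons w b)| <= #|left_ext x w|)%N.
  by rewrite /lexcess; lia.
apply/subset_leq_card/subsetP => a; rewrite mem_left_ext_rcons.
exact: bi_ext_left.
Qed.

(** In each square one factor is bounded by t(w); the remaining factors sum to at most t(w). *)
Lemma sum_sqr_lexcess w : language x w -> weak_or_neutral x w ->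
  (\sum_(b in right_ext x w) lexcess (rcons w b) ^ 2 <= lexcess w ^ 2)%N.
Proof.
move=> Lw wn.
apply: (@leq_trans (\sum_(b in right_ext x w) lexcess w * lexcess (rcons w b))).
  by apply: leq_sum => b _; rewrite -mulnn leq_mul2r lexcess_rcons orbT.
by rewrite -big_distrr -mulnn leq_mul2l sum_lexcess ?orbT.
Qed.

Lemma dendric_of_sum_sqr_lexcess w : language x w -> weak_or_neutral x w ->
  (\sum_(b in right_ext x w) lexcess (rcons w b) ^ 2)%N = (lexcess w ^ 2)%N ->
  dendric x w.
Proof.
move=> Lw wn eqsq.
have [b0 b0R leb0] : exists2 b0, b0 \in right_ext x w &
    (lexcess w <= lexcess (rcons w b0))%N.
  have /card_gt0P[b1 b1R] := right_ext_neq0 Lw.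
  (* If all t(wb) < t(w), the sum of squares is at most (t(w) - 1) t(w), which is less than t(w)^2
     because t(w) > 0. *)
  apply: contrapT => small.
  have lt_b b : b \in right_ext x w -> (lexcess (rcons w b) < lexcess w)%N.
    by move=> bR; rewrite ltnNge; apply/negP => le; apply: small; exists b.
  have t0 : (0 < lexcess w)%N by apply: leq_ltn_trans (lt_b _ b1R).
  suff : (lexcess w ^ 2 <= (lexcess w).-1 * lexcess w)%N.
    by rewrite -mulnn leq_mul2r; lia.
  rewrite -eqsq.
  apply: leq_trans (leq_mul (leqnn _) (sum_lexcess Lw wn)).
  rewrite big_distrr /=; apply: leq_sum => b bR.
  by rewrite -mulnn leq_mul2r; have := lt_b _ bR; lia.
have sub0 : (left_ext x (rcons w b0) \subset left_ext x w).
  by apply/subsetP => a; rewrite mem_left_ext_rcons; apply: bi_ext_left.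
have Lb b : b \in right_ext x w -> (0 < #|left_ext x (rcons w b)|)%N.
  by rewrite mem_right_ext => /asboolP/left_ext_neq0.
have l0 := left_ext_neq0 Lw.
apply: (dendric_of_dominating_ext Lw b0R).
  apply/eqP; rewrite eqEcard sub0 /=.
  by have := Lb _ b0R; move: leb0; rewrite /lexcess; lia.
(* The term of [b0] already exhausts the bound t(w), so t(wb) = 0. *)
move=> b bR bb0; have := sum_lexcess Lw wn.
rewrite (bigD1 b0) //= (bigD1 b) /=; last by rewrite bR.
by move: leb0; rewrite /lexcess; lia.
Qed.

(* The sum of t(v)^2 over the words v of the language that extend w to the
   right by k letters: a recursion that avoids indexing sums by words. *)
Fixpoint sqr_excess k w : nat :=
  if k is k'.+1 then \sum_(b in right_ext x w) sqr_excess k' (rcons w b)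
  else lexcess w ^ 2.

(** The induction moves letters from [k] to [w], keeping [size w + k] fixed, down to
    [sum_sqr_lexcess] at words of that length. *)
Lemma sqr_excess_dec K k w : holds_from x (weak_or_neutral x) K ->
  language x w -> (K <= size w + k)%N ->
  (sqr_excess k.+1 w <= sqr_excess k w)%N.
Proof.
move=> wn; elim: k w => [|k IHk] w Lw leK.
  by apply: sum_sqr_lexcess => //; apply: wn; split; rewrite ?addn0 in leK *.
rewrite [leqLHS]/= [leqRHS]/=; apply: leq_sum => b.
rewrite mem_right_ext => /asboolP Lb.
by apply: IHk => //; rewrite size_rcons addSnnS.
Qed.

(** Two equal sums whose terms are ordered one by one have equal terms, so equality passes from [w]
    to [rcons w b] and descends along [v]. *)
Lemma sqr_excess_eq K v w : holds_from x (weak_or_neutral x) K ->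
  language x (w ++ v) -> (K <= size w + size v)%N ->
  sqr_excess (size v).+1 w = sqr_excess (size v) w ->
  sqr_excess 1 (w ++ v) = sqr_excess 0 (w ++ v).
Proof.
move=> wn; elim: v w => [|b v IHv] w; first by rewrite cats0.
rewrite -cat_rcons => Lv leK eqw.
have bR : b \in right_ext x w.
  by rewrite mem_right_ext; apply/asboolP; apply: language_catl Lv.
apply: IHv => //; first by rewrite size_rcons addSnnS.
have dec c : c \in right_ext x w -> (sqr_excess (size v).+1 (rcons w c) <=
    sqr_excess (size v) (rcons w c))%N.
  rewrite mem_right_ext => /asboolP Lc.
  by apply: (sqr_excess_dec wn) => //; rewrite size_rcons addSnnS.
have : (\sum_(c in right_ext x w) sqr_excess (size v).+1 (rcons w c) =
        \sum_(c in right_ext x w) sqr_excess (size v) (rcons w c))%N by [].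
rewrite (bigD1 b) //= [X in _ = X](bigD1 b) //= -/(sqr_excess _.+1 _).
have := dec b bR.
have : (\sum_(c in right_ext x w | c != b) sqr_excess (size v).+1 (rcons w c) <=
        \sum_(c in right_ext x w | c != b) sqr_excess (size v) (rcons w c))%N.
  by apply: leq_sum => c /andP[cR _]; apply: dec.
rewrite /=; lia.
Qed.

Lemma eventually_weak_or_neutral_dendric :
  eventually x (weak_or_neutral x) -> eventually x (dendric x).
Proof.
case=> K wn; have L0 : language x [::] by exists 0%R, 0%N.
have [|N cst] := @eventually_constant (sqr_excess^~ [::]) K.
  by move=> n leKn; apply: sqr_excess_dec wn L0 _.
exists (maxn K N) => w [Lw]; rewrite geq_max => /andP[leK leN].
apply: (dendric_of_sum_sqr_lexcess Lw); first exact: wn.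
(* Rooted at the empty word, level n sums over all words of length n in the language; constancy at
   level [size w] descends to [w] itself. *)
exact: (@sqr_excess_eq K w [::]) (cst _ leN).
Qed.

End Extensions.

Theorem proposition4 (A : finType) (hA : (2 <= #|A|)%N) (x : int -> A) :
  [<-> eventually x (dendric x);
       eventually x (acyclic x);
       eventually x (neutral x);
       eventually x (weak_or_neutral x)]
  /\ (forall N M M' K : nat,
        is_threshold x (dendric x) N ->
        is_threshold x (acyclic x) M ->
        is_threshold x (neutral x) M' ->
        is_threshold x (weak_or_neutral x) K ->
        (K <= M <= N)%N /\ (K <= M' <= N)%N).
Proof.
(* These four implications hold word by word, hence with the same [n]; this is what compares the
   thresholds. *)
have dendric_acyclic n :
    holds_from x (dendric x) n -> holds_from x (acyclic x) n.
  by move=> h w /h[].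
have dendric_neutral' n :
    holds_from x (dendric x) n -> holds_from x (neutral x) n.
  by move=> h w Lw; apply: dendric_neutral (h _ Lw); case: Lw.
have acyclic_wn n :
    holds_from x (acyclic x) n -> holds_from x (weak_or_neutral x) n.
  by move=> h w Lw; apply: acyclic_weak_or_neutral (h _ Lw); case: Lw.
have neutral_wn n :
    holds_from x (neutral x) n -> holds_from x (weak_or_neutral x) n.
  by move=> h w /h; right.
split.
  tfae.
  - by case=> n /dendric_acyclic; exists n.
  (* An acyclic word may be weak, so neutrality is reached only through eventual dendricity,
     possibly from a larger length. *)
  - case=> n /acyclic_wn h.
    have [|N /dendric_neutral'] := @eventually_weak_or_neutral_dendric A x.
      by exists n.
    by exists N.
  - by case=> n /neutral_wn; exists n.
  - exact: eventually_weak_or_neutral_dendric.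
move=> N M M' K [hN _] [hM minM] [hM' minM'] [hK minK].
by rewrite !minK ?minM ?minM' //; auto.
Qed.
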